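(* Assume GCH. For every infinite regular cardinal $\kappa$ and every sequence $\bar p=\langle p_\delta:\delta<\kappa^{++}\rangle$ of partitions $p_\delta:[\kappa^{++}]^2\to\theta_\delta$ with $\theta_\delta\le\kappa^+$, $\Pr_0(\kappa^{++},\kappa^{++},\kappa^{++},\kappa)_{\bar p}$ holds.
   Context: $\Pr_0(\kappa,\mu,\lambda,\chi)_p$ for $p:[\kappa]^2\to\theta$: there is $f:[\kappa]^2\to\lambda$ such that for every $\xi<\chi$, every pairwise disjoint family $\mathcal A\subseteq[\kappa]^\xi$ with $|\mathcal A|=\mu$, and every matrix $\langle\zeta_{i,j}:i,j<\xi\rangle$ of elements of $\lambda^\theta$, there are $a,b\in\mathcal A$ with $\max a<\min b$ and $f(a(i),b(j))=\zeta_{i,j}(p(a(i),b(j)))$ for all $i,j<\xi$, where $a(i),b(j)$ are the $i$-th, $j$-th elements in increasing order. With a sequence $\bar p=\langle p_\delta\rangle$: a single $f$ witnesses this for every $p_\delta$. *)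

(* Defs.v *)
From Stdlib Require Import Classical FunctionalExtensionality.



Definition inj (X Y : Type) : Prop :=
  exists f : X -> Y, forall x y, f x = f y -> x = y.

Definition infinite (X : Type) : Prop := inj nat X.

Definition GCH : Prop :=
  forall X : Type, infinite X ->
  forall Y : Type, inj X Y -> inj Y (X -> Prop) ->
    inj Y X \/ inj (X -> Prop) Y.

(* A (strict) well-order, i.e. a representative of an ordinal. *)
Record WellOrder := {
  wo_car :> Type;
  wo_lt : wo_car -> wo_car -> Prop;
  wo_wf : well_founded wo_lt;
  wo_trans : forall x y z, wo_lt x y -> wo_lt y z -> wo_lt x z;
  wo_total : forall x y, wo_lt x y \/ x = y \/ wo_lt y x
}.

Arguments wo_lt {w} _ _.

Definition seg {W : WellOrder} (x : W) : Type := { y : W | wo_lt y x }.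

Definition is_cardinal (W : WellOrder) : Prop :=
  forall x : W, ~ inj W (seg x).

Definition is_regular_infinite_cardinal (W : WellOrder) : Prop :=
  is_cardinal W /\ infinite W /\
  forall S : W -> Prop,
    (forall x : W, exists y, S y /\ (x = y \/ wo_lt x y)) ->
    inj W { y : W | S y }.

Definition is_succ_cardinal (W W1 : WellOrder) : Prop :=
  is_cardinal W1 /\ inj W W1 /\ ~ inj W1 W /\
  forall x : W1, inj (seg x) W.

(* Pr_0(K2, K2, K2, K)_{p} for a sequence p = <p_delta : delta < K2> of
   colourings p_delta : [K2]^2 -> theta_delta.
   - a colouring of [K2]^2 is given as a binary function, only used on
     pairs alpha < beta;
   - xi < chi = kappa is an element of K, and the index set of a set
     a in [K2]^xi is seg xi, with a(i) the i-th element in increasing order,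
     i.e. a is represented by its strictly increasing enumeration;
   - a pairwise disjoint family of size mu = K2 is indexed by K2
     (distinct indices give disjoint sets);
   - "max a < min b" is read as: every element of a is below every
     element of b. *)
Definition Pr0_seq (K K2 : WellOrder) (theta : K2 -> Type)
    (p : forall delta : K2, K2 -> K2 -> theta delta) : Prop :=
  exists f : K2 -> K2 -> K2,
  forall delta : K2,
  forall xi : K,
  forall A : K2 -> seg xi -> K2,
    (forall g (i j : seg xi), wo_lt (proj1_sig i) (proj1_sig j) ->
        wo_lt (A g i) (A g j)) ->
    (forall g g' (i j : seg xi), g <> g' -> A g i <> A g' j) ->
  forall zeta : seg xi -> seg xi -> (theta delta -> K2),
  exists g g' : K2,
    (forall i j : seg xi, wo_lt (A g i) (A g' j)) /\
    (forall i j : seg xi,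
       f (A g i) (A g' j) = zeta i j (p delta (A g i) (A g' j))).

(* Main.v *)
From Stdlib Require Import Classical ClassicalEpsilon FunctionalExtensionality PropExtensionality.
From Stdlib Require Import Wellfounded List.
Require Import Defs.

(** Write [l = kappa^++], [m = kappa^+].  A walk from [b < l] down to [a] is governed by
    injections [e_b : b -> m]: each step goes to the point of [a, b) of least [e_b]-value, and
    that value is the entry of the step.  If [d] has cofinality [m], then for all [a < d]
    large enough the walk from [b] to [a] passes through [d]; since [cf d > kappa], this happens
    simultaneously for all points [b] of [kappa] many sets of size [< kappa], and the
    first entry below [d] can be made as large as desired.

    The node [d] is recovered from the entries alone: among the consecutive records of the
    sequence of entries one takes the pair [(x, o)] for which [h_o x] is largest, where
    [h_o : o -> kappa] is injective.  The entries above [d] can be made unbounded in [m] by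
    changing the upper set, so there are [kappa] many upper sets with pairwise disjoint sets of
    maximal entries [x]; as [h_o] is injective, one of them makes [h_o x] exceed any given
    bound [< kappa] for all the [o] coming from a fixed lower set.

    Since [l^m = l], a diagonal construction gives [row : l -> l -> V] which, for large [d], is
    constant with any prescribed value on some member of any given family of [m] disjoint
    small sets.  The colour of [(a, b)] is read off the value [row a d] at the decoded node
    [d]: it contains the index of the partition and a table which, applied to codes of [a] and
    [b] in [m] and to the part containing [(a, b)], returns the prescribed colour.  The codes
    separate the points of a small set because [l <= 2^m] and [2^kappa <= m]. *)

Declare Scope wo_scope.
Delimit Scope wo_scope with wo.
Local Open Scope wo_scope.

Definition wo_le {W : WellOrder} (x y : W) : Prop := ~ wo_lt y x.

Local Notation "x < y" := (wo_lt x y) : wo_scope.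
Local Notation "x <= y" := (wo_le x y) : wo_scope.

(** * Well-orders *)

Section Order.
Context {W : WellOrder}.
Implicit Types x y z : W.

Lemma lt_irrefl x : ~ x < x.
Proof.
  induction x as [x IH] using (well_founded_induction (wo_wf W)).
  intros H. exact (IH x H H).
Qed.

Lemma lt_le x y : x < y -> x <= y.
Proof. intros H H'. exact (lt_irrefl x (wo_trans W _ _ _ H H')). Qed.

Lemma le_refl x : x <= x.
Proof. apply lt_irrefl. Qed.

Lemma le_lt_or_eq x y : x <= y -> x < y \/ x = y.
Proof. intros H. destruct (wo_total W x y) as [L | [E | L]]; auto. contradiction. Qed.

Lemma lt_le_trans x y z : x < y -> y <= z -> x < z.
Proof.
  intros H H'. destruct (le_lt_or_eq _ _ H') as [L | <-]; trivial.
  exact (wo_trans W _ _ _ H L).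
Qed.

Lemma le_lt_trans x y z : x <= y -> y < z -> x < z.
Proof.
  intros H H'. destruct (le_lt_or_eq _ _ H) as [L | ->]; trivial.
  exact (wo_trans W _ _ _ L H').
Qed.

Lemma le_trans x y z : x <= y -> y <= z -> x <= z.
Proof. intros H H' L. exact (H (le_lt_trans _ _ _ H' L)). Qed.

Lemma le_antisym x y : x <= y -> y <= x -> x = y.
Proof. intros H H'. destruct (le_lt_or_eq _ _ H); trivial. contradiction. Qed.

Lemma lt_neq x y : x < y -> x <> y.
Proof. intros H ->. exact (lt_irrefl _ H). Qed.

Lemma ub2 x y : exists z, x <= z /\ y <= z.
Proof.
  destruct (classic (x < y)) as [H | H].
  - exists y. split; [exact (lt_le _ _ H) | apply le_refl].
  - exists x. split; [apply le_refl | exact H].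
Qed.

Lemma least (P : W -> Prop) :
  (exists x, P x) -> exists x, P x /\ forall y, P y -> x <= y.
Proof.
  intros [x Hx]. apply NNPP. intros N. revert Hx.
  induction x as [x IH] using (well_founded_induction (wo_wf W)).
  intros Hx. apply N. exists x. split; trivial.
  intros y Hy L. exact (IH y L Hy).
Qed.

Lemma seg_eq (d : W) (x y : seg d) : proj1_sig x = proj1_sig y -> x = y.
Proof.
  destruct x as [x Hx], y as [y Hy]; cbn. intros <-. f_equal. apply proof_irrelevance.
Qed.

(** The point [d] as an ordinal: [bdd (segW d) K] then expresses that the cofinality of [d] exceeds
    the size of [K]. *)
Definition segW (d : W) : WellOrder.
Proof.
  refine {| wo_car := seg d; wo_lt := fun s t => proj1_sig s < proj1_sig t |}.
  - apply (wf_inverse_image _ _ _ (@proj1_sig W _)), wo_wf.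
  - intros x y z. apply wo_trans.
  - intros x y. destruct (wo_total W (proj1_sig x) (proj1_sig y)) as [L | [E | L]]; auto.
    right; left. apply seg_eq, E.
Defined.

End Order.

Definition no_max (W : WellOrder) : Prop := forall x : W, exists y, x < y.

(** * Choice principles and injections *)

Lemma choice {X Y : Type} (R : X -> Y -> Prop) :
  (forall x, exists y, R x y) -> exists f, forall x, R x (f x).
Proof.
  intros H.
  exists (fun x => proj1_sig (constructive_indefinite_description _ (H x))).
  intros x. apply proj2_sig.
Qed.

Lemma wf_choice {X Y : Type} (R : X -> X -> Prop)
    (P : forall x, (forall x', R x' x -> Y) -> Y -> Prop) :
  well_founded R -> (forall x f, exists y, P x f y) ->
  exists F : X -> Y, forall x, P x (fun x' _ => F x') (F x).
Proof.
  intros wf H.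
  set (step := fun x f => proj1_sig (constructive_indefinite_description _ (H x f))).
  exists (Fix wf (fun _ => Y) step). intros x.
  rewrite Fix_eq at 1.
  - apply proj2_sig.
  - intros z f g E. replace g with f; trivial.
    apply functional_extensionality_dep; intros u.
    apply functional_extensionality_dep; intros h. apply E.
Qed.

Lemma inj_greedy {X Y : Type} (R : X -> X -> Prop) :
  well_founded R -> (forall x y, R x y \/ x = y \/ R y x) ->
  (forall x (f : forall x', R x' x -> Y), exists y, forall x' h, f x' h <> y) ->
  inj X Y.
Proof.
  intros wf tot H.
  destruct (wf_choice R (fun x f y => forall x' h, f x' h <> y) wf H) as [F HF].
  exists F. intros x y E. destruct (tot x y) as [L | [L | L]]; trivial.
  - destruct (HF y x L E).
  - symmetry in E. destruct (HF x y L E).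
Qed.

Lemma inj_trans {X Y Z : Type} : inj X Y -> inj Y Z -> inj X Z.
Proof. intros [f Hf] [g Hg]. exists (fun x => g (f x)). auto. Qed.

Lemma inj_prod {X X' Y Y' : Type} : inj X X' -> inj Y Y' -> inj (X * Y) (X' * Y').
Proof.
  intros [f Hf] [g Hg]. exists (fun p => (f (fst p), g (snd p))).
  intros [x y] [x' y'] E. injection E as E1 E2. f_equal; auto.
Qed.

Lemma inj_fun {X Y Y' : Type} : inj Y Y' -> inj (X -> Y) (X -> Y').
Proof.
  intros [f Hf]. exists (fun u x => f (u x)). intros u v E.
  apply functional_extensionality. intros x. apply Hf.
  exact (f_equal (fun w => w x) E).
Qed.

Lemma left_inverse {X Y : Type} (x0 : X) (f : X -> Y) :
  (forall x y, f x = f y -> x = y) -> exists g : Y -> X, forall x, g (f x) = x.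
Proof.
  intros Hf.
  destruct (choice (fun y x => forall x', f x' = y -> x = x')) as [g Hg].
  - intros y. destruct (classic (exists x, f x = y)) as [[x <-] | N].
    + exists x. intros x' E. symmetry. exact (Hf _ _ E).
    + exists x0. intros x' E. destruct N. eauto.
  - exists g. auto.
Qed.

Lemma inj_fun_dom {X X' Y : Type} (x0 : X) : inj X X' -> inj (X -> Y) (X' -> Y).
Proof.
  intros [f I]. destruct (left_inverse x0 f I) as [g H].
  exists (fun u x' => u (g x')). intros u v E.
  apply functional_extensionality. intros x.
  rewrite <- (H x). exact (f_equal (fun w => w (f x)) E).
Qed.

Lemma inj_curry {X Y Z : Type} : inj (X -> Y -> Z) (X * Y -> Z).
Proof.
  exists (fun u p => u (fst p) (snd p)). intros u v E.
  apply functional_extensionality; intros x. apply functional_extensionality; intros y.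
  exact (f_equal (fun w => w (x, y)) E).
Qed.

Lemma inj_pow {X Y : Type} : inj X Y -> inj (X -> Prop) (Y -> Prop).
Proof.
  intros [f Hf]. exists (fun S y => exists x, f x = y /\ S x). intros S T E.
  apply functional_extensionality; intros x.
  pose proof (f_equal (fun w => w (f x)) E) as Ex; cbn in Ex.
  assert (A : forall U : X -> Prop, (exists x', f x' = f x /\ U x') <-> U x).
  { intros U. split; eauto. intros [x' [E' H]]. now rewrite <- (Hf _ _ E'). }
  apply propositional_extensionality.
  rewrite <- (A S), <- (A T), Ex. reflexivity.
Qed.

(** One total function [e] spares later terms the proofs of [y < x]; [y0] is the value outside the
    segments. *)
Lemma seg_injections {W : WellOrder} {Y : Type} (y0 : Y) :
  (forall x : W, inj (seg x) Y) ->
  exists e : W -> W -> Y, forall x y z, y < x -> z < x -> e x y = e x z -> y = z.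
Proof.
  intros H.
  apply (choice (fun x (i : W -> Y) => forall y z, y < x -> z < x -> i y = i z -> y = z)).
  intros x. destruct (H x) as [i Hi].
  destruct (choice (fun y v => forall h : y < x, v = i (exist _ y h))) as [j Hj].
  - intros y. destruct (classic (y < x)) as [h | N].
    + exists (i (exist _ y h)). intros h'. now rewrite (proof_irrelevance _ h h').
    + exists y0. intros h. contradiction.
  - exists j. intros y z hy hz E. rewrite (Hj y hy), (Hj z hz) in E.
    apply Hi in E. exact (f_equal (@proj1_sig _ _) E).
Qed.

(** * Bounded maps and regularity *)

(** For nonempty [X]: the size of [X] is below the cofinality of [W]. *)
Definition bdd (W : WellOrder) (X : Type) : Prop :=
  forall f : X -> W, exists u, forall x, f x < u.

Definition regular (W : WellOrder) : Prop := forall m : W, bdd W (seg m).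

(** Boundedness for partial maps, presented as functional relations; [w0] fills the gaps. *)
Lemma bdd_rel {W : WellOrder} {X : Type} (w0 : W) (Q : X -> W -> Prop) :
  bdd W X -> (forall x w w', Q x w -> Q x w' -> w = w') ->
  exists u, forall x w, Q x w -> w < u.
Proof.
  intros B F.
  destruct (choice (fun x w => forall w', Q x w' -> w = w')) as [f Hf].
  - intros x. destruct (classic (exists w, Q x w)) as [[w H] | N].
    + exists w. intros w' H'. eauto.
    + exists w0. intros w' H'. destruct N; eauto.
  - destruct (B f) as [u Hu]. exists u. intros x w H. rewrite <- (Hf x w H). apply Hu.
Qed.

Lemma bdd_inj {W : WellOrder} {X Y : Type} (w0 : W) : inj Y X -> bdd W X -> bdd W Y.
Proof.
  intros [i Hi] B f.
  destruct (bdd_rel w0 (fun x w => exists y, i y = x /\ f y = w) B) as [u Hu].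
  - intros x w w' (y & <- & <-) (y' & E & <-). f_equal. symmetry. auto.
  - exists u. intros y. eauto.
Qed.

Lemma bdd_prod {W : WellOrder} {X Y : Type} : bdd W X -> bdd W Y -> bdd W (X * Y).
Proof.
  intros BX BY f.
  destruct (choice (fun x u => forall y, f (x, y) < u)) as [g Hg].
  - intros x. apply (BY (fun y => f (x, y))).
  - destruct (BX g) as [u Hu]. exists u. intros [x y].
    exact (wo_trans W _ _ _ (Hg x y) (Hu x)).
Qed.

(** Pigeonhole: if every fibre were bounded, [bdd W X] would bound all these bounds at once. *)
Lemma unbounded_fibre {W : WellOrder} {X : Type} (c : W -> X) (P : W -> Prop) :
  bdd W X -> (forall u, exists w, u <= w /\ P w) ->
  exists x, forall u, exists w, u <= w /\ P w /\ c w = x.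
Proof.
  intros B H. apply NNPP. intros N.
  destruct (choice (fun x u => forall w, u <= w -> P w -> c w <> x)) as [g Hg].
  - intros x. apply NNPP. intros N'. apply N. exists x. intros u.
    apply NNPP. intros N''. apply N'. exists u. intros w L Pw E. apply N''. eauto.
  - destruct (B g) as [u Hu]. destruct (H u) as [w [L Pw]].
    apply (Hg (c w) w); trivial. apply lt_le. exact (lt_le_trans _ _ _ (Hu _) L).
Qed.

Lemma fast_sequence {W1 W : WellOrder} (P : W -> Prop) (Phi : W -> W) :
  (forall m : W1, bdd W (seg m)) -> (forall u, exists w, u <= w /\ P w) ->
  exists f : W1 -> W, (forall x, P (f x)) /\ forall x y, x < y -> Phi (f x) < f y.
Proof.
  intros B H.
  destruct (wf_choice (@wo_lt W1)
    (fun x f w => P w /\ forall x' h, Phi (f x' h) < w)) as [F HF].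
  - apply wo_wf.
  - intros x f. destruct (B x (fun s => Phi (f (proj1_sig s) (proj2_sig s)))) as [u Hu].
    destruct (H u) as [w [L Pw]]. exists w. split; trivial. intros x' h.
    exact (lt_le_trans _ _ _ (Hu (exist _ x' h)) L).
  - exists F. split; intros; apply HF; trivial.
Qed.

(* Greedy enumeration of the pairs in Goedel's order: by regularity an initial
   segment, being contained in a square [seg m * seg m], cannot exhaust [W]. *)
Lemma regular_square {W : WellOrder} : no_max W -> regular W -> inj (W * W) W.
Proof.
  intros NM Rg.
  destruct (choice (fun (p : W * W) m => (m = fst p \/ m = snd p) /\ fst p <= m /\ snd p <= m))
    as [mx Hmx].
  { intros [a b]; cbn. destruct (classic (a < b)) as [L | L].
    - exists b. repeat split; auto using le_refl, lt_le.
    - exists a. repeat split; auto using le_refl. }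
  set (R := fun p q : W * W => mx p < mx q \/ (mx p = mx q /\
             (fst p < fst q \/ (fst p = fst q /\ snd p < snd q)))).
  apply (inj_greedy R).
  - assert (A : forall m a b p, mx p = m -> fst p = a -> snd p = b -> Acc R p).
    { intros m. induction m as [m IHm] using (well_founded_induction (wo_wf W)).
      intros a. induction a as [a IHa] using (well_founded_induction (wo_wf W)).
      intros b. induction b as [b IHb] using (well_founded_induction (wo_wf W)).
      intros p <- <- <-. constructor. intros q [L | [E [L | [E' L]]]]; eauto. }
    intros p. eapply A; reflexivity.
  - intros [a b] [a' b']. unfold R; cbn.
    destruct (wo_total W (mx (a, b)) (mx (a', b'))) as [L | [-> | L]]; auto.
    destruct (wo_total W a a') as [L | [-> | L]]; auto 6.
    destruct (wo_total W b b') as [L | [-> | L]]; auto 7.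
  - intros q f. destruct (NM (mx q)) as [m Hm].
    destruct (bdd_rel (mx q) (fun (s : seg m * seg m) w => exists p (h : R p q),
       fst p = proj1_sig (fst s) /\ snd p = proj1_sig (snd s) /\ f p h = w)) as [u Hu].
    + apply bdd_prod; apply Rg.
    + intros s w w' ([a b] & h & E1 & E2 & <-) ([a' b'] & h' & E1' & E2' & <-); cbn in *.
      subst. now rewrite (proof_irrelevance _ h h').
    + exists u. intros p h E.
      assert (L : mx p < m).
      { clear E. destruct h as [L | [-> _]]; trivial. exact (wo_trans W _ _ _ L Hm). }
      destruct (Hmx p) as [_ [L1 L2]].
      apply (lt_irrefl u). rewrite <- E at 1.
      apply (Hu (exist _ (fst p) (le_lt_trans _ _ _ L1 L), exist _ (snd p) (le_lt_trans _ _ _ L2 L))).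
      exists p, h. auto.
Qed.

(** * Cardinal arithmetic *)

(** An unbounded map from [seg m] has a cofinal range, so [K] would inject into that range and hence
    into [seg m], against being a cardinal. *)
Lemma regular_cardinal_regular (K : WellOrder) :
  is_regular_infinite_cardinal K -> no_max K /\ regular K.
Proof.
  intros [HC [[n Hn] HR]]. split.
  - intros x. apply NNPP. intros N.
    destruct (HR (fun y => y = x)) as [f Hf].
    + intros y. exists x. split; trivial.
      destruct (wo_total K y x) as [L | [E | L]]; auto. destruct N; eauto.
    + assert (E : 0 = 1); [| discriminate].
      apply Hn, Hf. destruct (f (n 0)) as [y ->], (f (n 1)) as [z ->]. reflexivity.
  - intros m f. apply NNPP. intros N. apply (HC m).
    apply (@inj_trans _ {y : K | exists s, f s = y}).
    + apply HR. intros x. apply NNPP. intros N'. apply N. exists x. intros s.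
      destruct (wo_total K (f s) x) as [L | L]; trivial.
      destruct N'. exists (f s). split; eauto. destruct L; auto.
    + destruct (choice (fun (y : {y : K | exists s, f s = y}) s => f s = proj1_sig y)) as [g Hg].
      * intros [y H]. exact H.
      * exists g. intros [y H] [y' H'] E.
        pose proof (Hg (exist _ y H)) as G. pose proof (Hg (exist _ y' H')) as G'.
        rewrite E, G' in G. cbn in G. subst. f_equal. apply proof_irrelevance.
Qed.

Section Successor.
Context (W W1 : WellOrder).
Hypothesis Winf : infinite W.
Hypothesis Wsq : inj (W * W) W.
Hypothesis WS : is_succ_cardinal W W1.

Lemma succ_no_max : no_max W1.
Proof.
  destruct WS as [_ [_ [NI SI]]], Winf as [n Hn]. intros x. apply NNPP. intros N.
  apply NI. apply (inj_trans (Y := W * W)); trivial.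
  destruct (SI x) as [f Hf].
  assert (T : forall y, y <> x -> y < x).
  { intros y E. destruct (wo_total W1 y x) as [L | [L | L]]; trivial; [contradiction |].
    destruct N; eauto. }
  (* The supposed maximum [x] is coded by [(n 0, n 1)], which differs from all other codes in the
     second component. *)
  destruct (choice (fun y p => (y = x /\ p = (n 0, n 1)) \/
      (exists h : y < x, p = (f (exist _ y h), n 0)))) as [g Hg].
  - intros y. destruct (classic (y = x)) as [-> | E].
    + exists (n 0, n 1). auto.
    + exists (f (exist _ y (T y E)), n 0). right. exists (T y E). reflexivity.
  - exists g. intros y z E.
    assert (D : n 0 <> n 1) by (intros D; apply Hn in D; discriminate).
    destruct (Hg y) as [[-> Ey] | [h Ey]], (Hg z) as [[-> Ez] | [h' Ez]]; trivial;
      rewrite Ey, Ez in E; try (injection E; congruence).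
    injection E as E. apply Hf in E. exact (f_equal (@proj1_sig _ _) E).
Qed.

Lemma succ_inhabited : inhabited W1.
Proof. destruct WS as [_ [[f _] _]], Winf as [n _]. constructor. exact (f (n 0)). Qed.

(** Were the values of [f] cofinal, each [y] could be coded by some [x] with [y < f x] together with
    the image of [y] under an injection of [seg (f x)] into [W]. *)
Lemma succ_bdd : bdd W1 W.
Proof.
  destruct WS as [_ [_ [NI SI]]], Winf as [n _]. intros f. apply NNPP. intros N. apply NI.
  apply (inj_trans (Y := W * W)); trivial.
  destruct (seg_injections (n 0) SI) as [e He].
  destruct (choice (fun y p => y < f (fst p) /\ snd p = e (f (fst p)) y)) as [g Hg].
  - intros y. destruct (succ_no_max y) as [y' Hy].
    assert (H : exists x, y' <= f x).
    { apply NNPP. intros N'. apply N. exists y'. intros x. apply NNPP. intros L. apply N'. eauto. }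
    destruct H as [x Hx]. exists (x, e (f x) y). split; trivial.
    exact (lt_le_trans _ _ _ Hy Hx).
  - exists g. intros y z E. destruct (Hg y) as [h Ey], (Hg z) as [h' Ez].
    rewrite <- E in h', Ez. apply (He (f (fst (g y)))); congruence.
Qed.

Lemma succ_regular : regular W1.
Proof.
  intros m. destruct WS as [_ [_ [_ SI]]], succ_inhabited as [w0].
  exact (bdd_inj w0 (SI m) succ_bdd).
Qed.

Lemma succ_infinite : infinite W1.
Proof. destruct WS as [_ [H _]]. exact (inj_trans Winf H). Qed.

(* Cantor's diagonal argument at each stage of the greedy enumeration. *)
Lemma succ_inj_pow : inj W1 (W -> Prop).
Proof.
  destruct WS as [_ [_ [_ SI]]].
  apply (inj_greedy (@wo_lt W1)); [apply wo_wf | apply wo_total |].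
  intros x f. destruct (SI x) as [i Hi].
  exists (fun w => exists s : seg x, i s = w /\ ~ f (proj1_sig s) (proj2_sig s) w).
  intros x' h E.
  pose proof (f_equal (fun S => S (i (exist _ x' h))) E) as E'; cbn in E'.
  assert (N : ~ f x' h (i (exist _ x' h))).
  { intros H. pose proof H as H'. rewrite E' in H'. destruct H' as [s [Es Hs]].
    apply Hi in Es. subst s. exact (Hs H). }
  apply N. rewrite E'. exists (exist _ x' h). split; trivial.
Qed.

(** [GCH] is applied here: [W1] lies between [W] and its power set and does not inject into [W]. *)
Lemma succ_pow_inj : GCH -> inj (W -> Prop) W1.
Proof.
  intros G. destruct WS as [_ [I [NI _]]].
  destruct (G W Winf W1 I succ_inj_pow) as [H | H]; trivial. contradiction.
Qed.

(** Exponents multiply: [W1^W] is at most [(2^W)^W = 2^(W * W) = 2^W]. *)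
Lemma succ_fun_inj : GCH -> inj (W -> W1) W1.
Proof.
  intros G. apply (inj_trans (inj_fun succ_inj_pow)).
  apply (inj_trans inj_curry). apply (inj_trans (inj_pow Wsq)). apply succ_pow_inj, G.
Qed.

End Successor.

Definition in_seg {W : WellOrder} {d x : W} (h : x < d) : seg d := exist (fun y => y < d) x h.

(** * Walks *)

Section Walk.
Context {K M L : WellOrder} (e : L -> L -> M).
Hypothesis e_inj : forall b x y, x < b -> y < b -> e b x = e b y -> x = y.
Hypothesis M_seg : forall m : M, inj (seg m) K.

Definition Step (a b c : L) : Prop :=
  a <= c /\ c < b /\ forall x, a <= x -> x < b -> e b c <= e b x.

(** An item pairs the node being left with the entry of the step, so that nodes can be read off the
    list; the end point [a] is not listed. *)
Inductive Walk (a : L) : L -> list (L * M) -> Prop :=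
| walk_nil : Walk a a nil
| walk_cons b c l : Step a b c -> Walk a c l -> Walk a b ((b, e b c) :: l).

Lemma step_exists a b : a < b -> exists c, Step a b c.
Proof.
  intros H.
  destruct (least (fun m => exists c, a <= c /\ c < b /\ e b c = m)) as [m [(c & H1 & H2 & <-) H3]].
  - exists (e b a), a. auto using le_refl.
  - exists c. repeat split; trivial. intros x Hx Hx'. apply H3. eauto.
Qed.

Lemma step_unique a b c c' : Step a b c -> Step a b c' -> c = c'.
Proof.
  intros (H1 & H2 & H3) (H1' & H2' & H3'). apply (e_inj b); trivial.
  apply le_antisym; auto.
Qed.

Lemma step_lt a b c : Step a b c -> a < b.
Proof. intros (H1 & H2 & _). exact (le_lt_trans _ _ _ H1 H2). Qed.

Lemma walk_exists a b : a <= b -> exists l, Walk a b l.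
Proof.
  induction b as [b IH] using (well_founded_induction (wo_wf L)). intros H.
  destruct (le_lt_or_eq _ _ H) as [H' | <-].
  - destruct (step_exists a b H') as [c Hc]. pose proof Hc as (H1 & H2 & _).
    destruct (IH c H2 H1) as [l Hl]. eexists. econstructor; eassumption.
  - eexists. constructor.
Qed.

Lemma walk_unique a b l l' : Walk a b l -> Walk a b l' -> l = l'.
Proof.
  intros H. revert l'. induction H as [| b c l S H IH]; intros l' H'.
  - inversion H' as [| b c l S H]; subst; trivial.
    destruct (lt_irrefl _ (step_lt _ _ _ S)).
  - inversion H' as [| b' c' l'' S' H'']; subst.
    + destruct (lt_irrefl _ (step_lt _ _ _ S)).
    + rewrite (step_unique _ _ _ _ S' S) in *. f_equal. auto.
Qed.

Lemma walk_head a b l : a < b -> Walk a b l ->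
  exists c l', Step a b c /\ l = (b, e b c) :: l'.
Proof.
  intros H H'. inversion H' as [| b' c l' S H'']; subst.
  - destruct (lt_irrefl _ H).
  - eauto.
Qed.

(** The points below [d] with [e b]-value less than [m] number at most [K], so they are bounded in
    [d], whose cofinality is larger. *)
Lemma small_bounded (d b : L) (m : M) : inhabited (seg d) -> bdd (segW d) K -> d <= b ->
  exists y, y < d /\ forall x, y <= x -> x < d -> m <= e b x.
Proof.
  intros [x0] B H.
  destruct (bdd_rel (W := segW d) x0 (fun (s : seg m) (w : segW d) => e b (proj1_sig w) = proj1_sig s))
    as [u Hu].
  - exact (bdd_inj (W := segW d) x0 (M_seg m) B).
  - intros s [w Hw] [w' Hw'] E E'; cbn in *. apply seg_eq; cbn.
    apply (e_inj b); [eapply lt_le_trans; eassumption .. | congruence].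
  - exists (proj1_sig u). split; [apply (proj2_sig u) |]. intros x Hx Hxd Hm. apply Hx.
    exact (Hu (in_seg Hm) (in_seg Hxd) eq_refl).
Qed.

(* Above a bound [y < d], no [x < d] competes with a step of the walk from [b] to [d],
   so the walk to any such [x] goes through [d]. *)
Lemma walk_through (d b : L) s : inhabited (seg d) -> bdd (segW d) K -> Walk d b s ->
  exists y, y < d /\ forall a t, y <= a -> a < d -> Walk a d t -> Walk a b (s ++ t).
Proof.
  intros I B H. induction H as [| b c s S H IH].
  - destruct I as [[y Hy]]. exists y. auto.
  - destruct IH as (y & Hy & IH).
    destruct (small_bounded d b (e b c) I B (lt_le _ _ (step_lt _ _ _ S))) as (y' & Hy' & H').
    assert (Z : exists z, z < d /\ y <= z /\ y' <= z).
    { destruct (classic (y < y')) as [L1 | L1].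
      - exists y'. auto using lt_le, le_refl.
      - exists y. auto using le_refl. }
    destruct Z as (z & Hz & L1 & L2). exists z. split; trivial. intros a t Ha Had Ht.
    destruct S as (S1 & S2 & S3). cbn. constructor.
    + split; [| split]; trivial.
      * exact (le_trans _ _ _ (lt_le _ _ Had) S1).
      * intros x Hx Hxb. destruct (classic (x < d)) as [Hxd | Hxd].
        -- apply H'; trivial. eauto using le_trans.
        -- apply S3; trivial.
    + apply IH; trivial. eauto using le_trans.
Qed.

(** Induction on [b]: a first step is determined by its entry, so entries below [n] lead to at most
    [seg n] many points, and regularity of [M] bounds the bounds obtained for these. *)
Lemma walk_small_entries (F : L -> M) (b : L) (n : M) : no_max M -> regular M ->
  exists u, forall d l, Walk d b l -> (forall q, In q l -> snd q < n) -> F d < u.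
Proof.
  intros NM RM. induction b as [b IH] using (well_founded_induction (wo_wf L)).
  destruct (choice (fun (o : seg n) u => forall c, c < b -> e b c = proj1_sig o ->
    forall d l, Walk d c l -> (forall q, In q l -> snd q < n) -> F d < u)) as [g Hg].
  - intros o. destruct (classic (exists c, c < b /\ e b c = proj1_sig o)) as [(c & Hc & E) | N].
    + destruct (IH c Hc) as [u Hu]. exists u. intros c' Hc' E'.
      rewrite (e_inj b c' c); trivial. congruence.
    + exists n. intros c Hc E. destruct N; eauto.
  - destruct (RM n g) as [u Hu], (NM (F b)) as [v Hv], (ub2 u v) as (w & Hw1 & Hw2).
    exists w. intros d l H Hl. destruct H as [| b c l S H].
    + exact (lt_le_trans _ _ _ Hv Hw2).
    + assert (Ho : e b c < n) by (apply (Hl (b, e b c)); left; reflexivity).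
      apply (lt_le_trans _ u); trivial.
      apply (wo_trans M _ (g (in_seg Ho))); trivial.
      destruct S as (_ & S2 & _).
      apply (Hg (in_seg Ho) c S2 eq_refl d l H). intros q Hq. apply Hl. right. exact Hq.
Qed.

End Walk.

(** * Decoding a node of a walk *)

Lemma list_ub {W : WellOrder} (l : list W) : inhabited W -> no_max W ->
  exists u, forall x, In x l -> x < u.
Proof.
  intros [w0] NM. induction l as [| a l [u Hu]].
  - exists w0. intros x [].
  - destruct (NM a) as [v Hv], (ub2 u v) as (w & H1 & H2). exists w.
    intros x [<- | H]; eauto using lt_le_trans.
Qed.

Lemma list_max {W : WellOrder} (l : list W) : l <> nil ->
  exists x, In x l /\ forall y, In y l -> y <= x.
Proof.
  induction l as [| a l IH]; [congruence |]. intros _.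
  destruct l as [| b l].
  - exists a. split; [now left |]. intros y [<- | []]. apply le_refl.
  - destruct IH as (x & Hx & H); [discriminate |].
    destruct (classic (a < x)) as [L | L].
    + exists x. split; [now right |]. intros y [<- | Hy]; auto using lt_le.
    + exists a. split; [now left |]. intros y [<- | Hy]; auto using le_refl.
      exact (le_trans _ _ _ (H y Hy) L).
Qed.

Section Decode.
Context {K M L : WellOrder} (h : M -> M -> K).

Definition record_pair (l : list (L * M)) (d : L) (x o : M) : Prop :=
  exists l1 l2, l = l1 ++ (d, o) :: l2 /\ In x (map snd l1) /\
    (forall y, In y (map snd l1) -> y <= x) /\ x < o.

(** The maximum of [h o x] has to be strict, which makes the decoded node unique. *)
Definition decodes (l : list (L * M)) (d : L) : Prop :=
  exists x o, record_pair l d x o /\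
    forall d' x' o', record_pair l d' x' o' ->
      (d' = d /\ x' = x /\ o' = o) \/ h o' x' < h o x.

Lemma decodes_unique l d d' : decodes l d -> decodes l d' -> d = d'.
Proof.
  intros (x & o & H1 & H2) (x' & o' & H1' & H2').
  destruct (H2 _ _ _ H1') as [[E _] | A]; [congruence |].
  destruct (H2' _ _ _ H1) as [[E _] | A']; trivial.
  destruct (lt_le _ _ A A').
Qed.

Lemma record_pair_bound l : inhabited K -> no_max K ->
  exists u, forall d x o, record_pair l d x o -> h o x < u.
Proof.
  intros I NM.
  destruct (list_ub (map (fun q => h (fst q) (snd q)) (list_prod (map snd l) (map snd l))) I NM)
    as [u Hu].
  exists u. intros d x o (l1 & l2 & -> & Hx & _ & _). apply Hu.
  apply in_map_iff. exists (o, x). split; trivial.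
  rewrite map_app. apply in_prod; apply in_or_app; auto. right. now left.
Qed.

(** A record pair of the whole list lies inside [s], at the junction, or later. In the last case [o]
    precedes it, so its first component is at least [o], hence above [x], and the pair is a record
    pair of the tail alone. *)
Lemma decodes_app s d o t x u :
  In x (map snd s) -> (forall y, In y (map snd s) -> y <= x) -> x < o ->
  (forall d' x' o', record_pair s d' x' o' -> h o' x' < u) ->
  (forall d' x' o', record_pair ((d, o) :: t) d' x' o' -> h o' x' < u) ->
  u <= h o x ->
  decodes (s ++ (d, o) :: t) d.
Proof.
  intros Hx Hmax Hxo Hs Ht Hu. exists x, o. split.
  - exists s, t. auto.
  - intros d' x' o' (l1 & l2 & E & Hx' & Hmax' & Hxo').
    apply app_eq_app in E as [[| q l] [[E1 E2] | [E1 E2]]].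
    + rewrite app_nil_r in E1. subst l1. injection E2 as -> -> ->. left. auto using le_antisym.
    + rewrite app_nil_r in E1. subst l1. injection E2 as -> -> ->. left. auto using le_antisym.
    + right. injection E2 as <- E2. apply (lt_le_trans _ u); trivial. apply (Hs d').
      exists l1, l. auto.
    + right. injection E2 as <- ->. subst l1. rewrite map_app in Hx', Hmax'.
      apply (lt_le_trans _ u); trivial. apply (Ht d').
      assert (Ho : o <= x') by (apply Hmax', in_or_app; right; now left).
      exists ((d, o) :: l), l2. repeat split; trivial.
      * apply in_app_or in Hx' as [H |]; trivial.
        destruct (Hmax _ H). exact (lt_le_trans _ _ _ Hxo Ho).
      * intros y Hy. apply Hmax', in_or_app. now right.
Qed.

End Decode.

(** * A generic colouring, separating codes and closure points *)

Definition disjoint_family {G I Y : Type} (A : G -> I -> Y) : Prop :=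
  forall x y i j, x <> y -> A x i <> A y j.

(* There are only [|L|] pairs of a family and a value, and only [|M|] of them are
   considered below [d]; a disjoint member of each of these families is selected
   in [M] steps. *)
Lemma generic_rows {K M L : WellOrder} {V : Type} (v0 : V) (e : L -> L -> M) :
  inhabited M -> inhabited L ->
  (forall b x y, x < b -> y < b -> e b x = e b y -> x = y) ->
  regular M -> bdd M K -> inj ((M -> K -> L) * V) L ->
  exists g : L -> L -> V, forall A : M -> K -> L, disjoint_family A ->
    forall v, exists c, forall d, c < d -> exists x, forall i, g (A x i) d = v.
Proof.
  intros [m0] [l0] He RM BMK [f Hf].
  destruct (left_inverse (fun _ _ => l0, v0) f Hf) as [dec Hdec].
  set (fam := fun c => fst (dec c)).
  assert (H : forall d, exists row : L -> V, forall c, c < d -> disjoint_family (fam c) ->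
            exists x, forall i, row (fam c x i) = snd (dec c)).
  { intros d.
    destruct (wf_choice (fun c' c => e d c' < e d c)
      (fun c (r : forall c', e d c' < e d c -> M) x => c < d -> disjoint_family (fam c) ->
         forall c' h, c' < d -> forall i j, fam c x i <> fam c' (r c' h) j)) as [F HF].
    - apply wf_inverse_image, wo_wf.
    - intros c r. destruct (classic (c < d /\ disjoint_family (fam c))) as [[Hc D] | N].
      (* By disjointness a point of an earlier chosen member lies in at most one member of [fam c],
         so the indices to avoid form the range of a partial map on [seg (e d c) * K]. *)
      + destruct (bdd_rel m0 (fun (q : seg (e d c) * K) x => exists c' h, c' < d /\
           e d c' = proj1_sig (fst q) /\ exists i, fam c x i = fam c' (r c' h) (snd q)))
          as [u Hu].
        * apply bdd_prod; trivial.
        * intros q x x' (c1 & h1 & H1 & E1 & i1 & F1) (c2 & h2 & H2 & E2 & i2 & F2).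
          assert (c1 = c2) by (apply (He d); congruence). subst c2.
          rewrite (proof_irrelevance _ h2 h1) in F2.
          apply NNPP. intros N. apply (D x x' i1 i2 N). congruence.
        * exists u. intros _ _ c' h Hc' i j E. apply (lt_irrefl u).
          apply (Hu (in_seg h, j)). exists c', h. eauto.
      + exists m0. intros Hc D. destruct N. auto.
    - destruct (choice (fun a v => forall c, c < d -> disjoint_family (fam c) ->
         (exists i, fam c (F c) i = a) -> v = snd (dec c))) as [row Hrow].
      + intros a. destruct (classic (exists c, c < d /\ disjoint_family (fam c) /\
          exists i, fam c (F c) i = a)) as [(c & Hc & D & i & E) | N].
        * exists (snd (dec c)). intros c' Hc' D' [i' E'].
          destruct (wo_total M (e d c) (e d c')) as [Hl | [El | Hl]].
          -- destruct (HF c' Hc' D' c Hl Hc i' i). congruence.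
          -- rewrite (He d c c'); trivial.
          -- destruct (HF c Hc D c' Hl Hc' i i'). congruence.
        * exists v0. intros c Hc D E. destruct N. eauto.
      + exists row. intros c Hc D. exists (F c). intros i. apply Hrow; eauto. }
  destruct (choice _ H) as [row Hrow]. exists (fun a d => row d a).
  intros A D v. exists (f (A, v)). intros d Hd.
  destruct (Hrow d (f (A, v)) Hd) as [x Hx]; unfold fam in *; rewrite Hdec in *; eauto.
Qed.

(** The code of [b] at level [n] records the trace below [n] of the subset of [M] attached to [b]. A
    level beyond one difference for each pair of distinct points separates them all. *)
Lemma separating_codes {K M L : WellOrder} :
  inhabited M -> inj L (M -> Prop) -> inj (K -> Prop) M -> (forall m : M, inj (seg m) K) ->
  exists y : L -> M -> M, forall (xi : K) (a : seg xi -> L), bdd M (seg xi) ->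
    exists n, forall i j, y (a i) n = y (a j) n -> a i = a j.
Proof.
  intros [m0] [x Hx] IK SM.
  destruct (choice (fun n (code : (M -> Prop) -> M) =>
     forall S T, code S = code T -> forall m, m < n -> S m = T m)) as [code Hcode].
  - intros n. destruct (inj_trans (inj_pow (SM n)) IK) as [c Hc].
    exists (fun S => c (fun s => S (proj1_sig s))). intros S T E m Hm.
    apply Hc in E. exact (f_equal (fun U => U (in_seg Hm)) E).
  - exists (fun b n => code n (x b)). intros xi a B.
    assert (D : exists D : seg xi * seg xi -> M, forall q,
       x (a (fst q)) (D q) = x (a (snd q)) (D q) -> a (fst q) = a (snd q)).
    { apply (choice (fun q m => x (a (fst q)) m = x (a (snd q)) m -> a (fst q) = a (snd q))).
      intros [i j]; cbn. apply NNPP. intros N.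
      assert (E : a i = a j).
      { apply Hx, functional_extensionality. intros m. apply NNPP. intros N'.
        apply N. exists m. intros E. contradiction. }
      apply N. exists m0. trivial. }
    destruct D as [D HD], (bdd_prod B B D) as [n Hn]. exists n. intros i j E.
    apply (HD (i, j)). exact (Hcode n _ _ E _ (Hn (i, j))).
Qed.

(** [d] is the supremum of an increasing sequence of length [M] whose terms exceed [Phi] of all
    earlier terms; a map from [K] below [d] stays below one term by [bdd M K]. *)
Lemma closure_points {K M L : WellOrder} (Phi : L -> L) :
  inhabited M -> no_max M -> bdd M K -> bdd L M ->
  (forall m : M, bdd L (seg m)) ->
  forall z, exists d, z < d /\ bdd (segW d) K /\
    forall y, y < d -> exists y', y <= y' /\ y' < d /\ Phi y' < d.
Proof.
  intros [m0] NM BMK BLM BS z.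
  destruct (choice (fun x w => x <= w /\ Phi x <= w)) as [Psi HPsi].
  { intros x. apply ub2. }
  destruct (@fast_sequence M L (wo_le z) Psi BS) as (f & Hz & Hf).
  { intros u. destruct (ub2 u z) as (w & H1 & H2). eauto. }
  assert (Hinc : forall x y, x < y -> f x < f y).
  { intros x y H. exact (le_lt_trans _ _ _ (proj1 (HPsi (f x))) (Hf x y H)). }
  destruct (least (fun u => forall x, f x < u) (BLM f)) as (d & Hd & Hmin).
  assert (Hcof : forall y, y < d -> exists x, y <= f x).
  { intros y Hy. apply NNPP. intros N. apply (Hmin y); trivial.
    intros x. apply NNPP. intros N'. eauto. }
  exists d. split; [| split].
  - exact (le_lt_trans _ _ _ (Hz m0) (Hd m0)).
  - intros g. destruct (choice (fun k x => proj1_sig (g k) <= f x)) as [x Hx].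
    { intros k. apply Hcof, (proj2_sig (g k)). }
    destruct (BMK x) as [u Hu]. exists (in_seg (Hd u)). intros k; cbn.
    exact (le_lt_trans _ _ _ (Hx k) (Hinc _ _ (Hu k))).
  - intros y Hy. destruct (Hcof y Hy) as [x Hx], (NM x) as [x' Hx'].
    exists (f x). split; [| split]; trivial.
    exact (le_lt_trans _ _ _ (proj2 (HPsi (f x))) (wo_trans L _ _ _ (Hf x x' Hx') (Hd x'))).
Qed.

(** * Uniform decoding *)

Section Uniform.
Context {K M L : WellOrder} (e : L -> L -> M) (h : M -> M -> K).
Hypothesis e_inj : forall b x y, x < b -> y < b -> e b x = e b y -> x = y.
Hypothesis h_inj : forall o x y, x < o -> y < o -> h o x = h o y -> x = y.
Hypotheses (K0 : inhabited K) (M0 : inhabited M) (L0 : inhabited L).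
Hypotheses (NK : no_max K) (NM : no_max M) (NL : no_max L).
Hypotheses (RK : regular K) (RM : regular M) (RL : regular L).
Hypotheses (BMK : bdd M K) (BLM : bdd L M) (M_seg : forall m : M, inj (seg m) K).
Hypothesis BLs : forall m : M, bdd L (seg m).
Hypothesis BMs : forall k : K, bdd M (seg k).

Context (xi : K) (A : L -> seg xi -> L) (B : L -> Prop).
Hypothesis A_disj : disjoint_family A.

(** Each point lies in at most one member, so regularity bounds the indices of the members that meet
    the points up to [z]. *)
Lemma far_member : (forall u, exists g, u <= g /\ B g) ->
  forall u z, exists g, u <= g /\ B g /\ forall j, z < A g j.
Proof.
  intros HB u z. destruct L0 as [l0], (NL z) as [z' Hz].
  destruct (bdd_rel l0 (fun (s : seg z') g => exists j, A g j = proj1_sig s) (RL z')) as [v Hv].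
  - intros s g g' [j E] [j' E']. apply NNPP. intros N. apply (A_disj g g' j j' N). congruence.
  - destruct (ub2 u v) as (w & Hu & Hw), (HB w) as (g & Hg & Bg).
    exists g. split; [| split]; eauto using le_trans.
    intros j. apply NNPP. intros N.
    assert (Hj : A g j < z') by exact (le_lt_trans _ _ _ N Hz).
    apply (le_trans _ _ _ Hw Hg). apply (Hv (in_seg Hj)). exists j. reflexivity.
Qed.

Hypothesis B_unbounded : forall u, exists g, u <= g /\ B g.

(* If every closure point [d] had a bound [n] such that all members beyond [d] have a
   walk to [d] with entries below [n], then some [n] would serve [|M|] many points [d], and by
   pigeonhole one point of a member beyond all of them would contradict
   [walk_small_entries]. *)
Lemma spread_point (Phi : L -> L) :
  exists d, inhabited (seg d) /\ bdd (segW d) K /\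
    (forall y, y < d -> exists y', y <= y' /\ y' < d /\ Phi y' < d) /\
    forall n : M, exists g, B g /\ (forall j, d < A g j) /\
      forall j l, Walk e d (A g j) l -> exists q, In q l /\ n <= snd q.
Proof.
  destruct L0 as [l0], M0 as [m0].
  set (good := fun d => inhabited (seg d) /\ bdd (segW d) K /\
    forall y, y < d -> exists y', y <= y' /\ y' < d /\ Phi y' < d).
  apply NNPP. intros N.
  destruct (choice (fun d n => good d -> forall g, B g -> (forall j, d < A g j) ->
    exists j l, Walk e d (A g j) l /\ forall q, In q l -> snd q < n)) as [nu Hnu].
  { intros d. apply NNPP. intros N1. apply N. exists d.
    assert (Gd : good d) by (apply NNPP; intros N2; apply N1; exists m0; contradiction).
    destruct Gd as (G1 & G2 & G3). do 3 (split; trivial). intros n. apply NNPP. intros N2.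
    apply N1. exists n. intros _ g Bg Hg. apply NNPP. intros N3. apply N2. exists g.
    do 2 (split; trivial). intros j l Hl. apply NNPP. intros N4. apply N3. exists j, l.
    split; trivial. intros q Hq. apply NNPP. intros N5. apply N4. eauto. }
  destruct (unbounded_fibre nu good BLM) as [n Hn].
  { intros u. destruct (closure_points Phi M0 NM BMK BLM BLs u) as (d & Hd & G2 & G3).
    exists d. split; [apply lt_le; trivial |]. split; auto.
    constructor. exact (in_seg Hd). }
  destruct (@fast_sequence M L (fun d => good d /\ nu d = n) (fun x => x) BLs Hn) as (D & HD & Dinc).
  (* [F] returns the index of a point of [D], so [walk_small_entries] bounds the indices of those
     points of [D] that are reached with entries below [n]. *)
  destruct (left_inverse m0 D) as [F HF].
  { intros x y E. destruct (wo_total M x y) as [Hl | [Hl | Hl]]; trivial;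
      apply Dinc in Hl; rewrite E in Hl; destruct (lt_irrefl _ Hl). }
  destruct (BLM D) as [z Hz], (far_member B_unbounded z z) as (g & _ & Bg & Hg).
  destruct (choice (fun j u => forall d l, Walk e d (A g j) l ->
      (forall q, In q l -> snd q < n) -> F d < u)) as [v Hv].
  { intros j. apply (walk_small_entries e e_inj); trivial. }
  destruct (BMs xi v) as [u Hu], (HD u) as [Gu Eu].
  destruct (Hnu _ Gu g Bg) as (j & l & Hl & Hq).
  { intros j. exact (wo_trans L _ _ _ (Hz u) (Hg j)). }
  rewrite Eu in Hq. specialize (Hv j _ _ Hl Hq). rewrite HF in Hv.
  exact (lt_irrefl _ (wo_trans M _ _ _ Hv (Hu j))).
Qed.

Lemma uniform_decoding (d : L) :
  inhabited (seg d) -> bdd (segW d) K ->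
  (forall n : M, exists g, B g /\ (forall j, d < A g j) /\
      forall j l, Walk e d (A g j) l -> exists q, In q l /\ n <= snd q) ->
  exists y, y < d /\ forall a : seg xi -> L, (forall i, y <= a i /\ a i < d) ->
    exists g, B g /\ (forall j, d < A g j) /\
      forall i j l, Walk e (a i) (A g j) l -> decodes h l d.
Proof.
  intros Id Bd Hd.
  destruct (choice _ Hd) as [G HG].
  assert (Hs : exists s : M * seg xi -> list (L * M), forall q, Walk e d (A (G (fst q)) (snd q)) (s q)).
  { apply (choice (fun q l => Walk e d (A (G (fst q)) (snd q)) l)). intros [n j].
    apply walk_exists, lt_le, HG. }
  destruct Hs as [s Hs].
  destruct (choice (fun q x => fst q <= x /\ In x (map snd (s q)) /\
     forall y, In y (map snd (s q)) -> y <= x)) as [X HX].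
  { intros [n j]. destruct (HG n) as (_ & _ & Hn).
    destruct (Hn j _ (Hs (n, j))) as (r & Hr & Hnr).
    apply (in_map snd) in Hr.
    destruct (list_max (map snd (s (n, j)))) as (x & Hx & Hmax).
    - intros E. rewrite E in Hr. destruct Hr.
    - exists x. repeat split; trivial. exact (le_trans _ _ _ Hnr (Hmax _ Hr)). }
  destruct (choice (fun q u => forall d' x o, record_pair (s q) d' x o -> h o x < u)) as [th Hth].
  { intros q. apply record_pair_bound; trivial. }
  destruct (choice (fun n u => forall j, th (n, j) < u)) as [Th HTh].
  { intros n. apply (RK xi (fun j => th (n, j))). }
  (* One bound [t0] for the record pairs of the upper parts serves unboundedly many [n]. *)
  destruct (unbounded_fibre Th (fun _ => True) BMK) as [t0 Ht0].
  { intros u. exists u. auto using le_refl. }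
  destruct (choice (fun n u => forall j, X (n, j) < u)) as [Phi HPhi].
  { intros n. apply (BMs xi (fun j => X (n, j))). }
  (* Since [X (n, j)] is at least [n], going beyond all earlier maxima keeps the sets of maxima for
     different [k] disjoint. *)
  destruct (@fast_sequence K M (fun n => Th n = t0) Phi BMs) as (nn & Hnn & nn_fast).
  { intros u. destruct (Ht0 u) as (n & H1 & _ & H2). eauto. }
  (* An entry of at least [U] at the node [d] is a new record after each of these upper parts. *)
  destruct (bdd_prod BMK (BMs xi) (fun q => X (nn (fst q), snd q))) as [U HU].
  assert (Hy1 : exists y1, y1 < d /\ forall k j a t, y1 <= a -> a < d -> Walk e a d t ->
              Walk e a (A (G (nn k)) j) (s (nn k, j) ++ t)).
  { destruct (choice (fun (q : K * seg xi) (y : segW d) => forall a t, proj1_sig y <= a -> a < d ->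
      Walk e a d t -> Walk e a (A (G (nn (fst q))) (snd q)) (s (nn (fst q), snd q) ++ t))) as [Y HY].
    - intros [k j]. destruct (walk_through e e_inj M_seg d _ _ Id Bd (Hs (nn k, j))) as (y & Hy & H).
      exists (in_seg Hy). exact H.
    - assert (BX : bdd (segW d) (K * seg xi)).
      { apply bdd_prod; trivial. destruct Id as [x0]. apply (bdd_inj (W := segW d) x0 (X := K)); trivial.
        exists (@proj1_sig _ _). apply seg_eq. }
      destruct (BX Y) as [[y1 Hy1] HyY]. exists y1. split; trivial. intros k j a t Ha.
      apply (HY (k, j)). apply (le_trans _ y1); trivial. apply lt_le. exact (HyY (k, j)). }
  destruct Hy1 as (y1 & Hy1 & Hwalk).
  destruct (small_bounded e e_inj M_seg d d U Id Bd (le_refl d)) as (y2 & Hy2 & Hfirst).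
  assert (Hy : exists y, y < d /\ y1 <= y /\ y2 <= y).
  { destruct (classic (y1 < y2)).
    - exists y2. auto using lt_le, le_refl.
    - exists y1. auto using le_refl. }
  destruct Hy as (y & Hyd & Hyy1 & Hyy2). exists y. split; trivial. intros a Ha.
  destruct (choice (fun i (ot : M * list (L * M)) => U <= fst ot /\
     Walk e (a i) d ((d, fst ot) :: snd ot))) as [ot Hot].
  { intros i. destruct (Ha i) as [Hi1 Hi2].
    destruct (walk_exists e (a i) d (lt_le _ _ Hi2)) as [l Hl].
    destruct (walk_head e (a i) d l Hi2 Hl) as (c & l' & (S1 & S2 & _) & ->).
    exists (e d c, l'). split; trivial. apply Hfirst; trivial.
    exact (le_trans _ _ _ Hyy2 (le_trans _ _ _ Hi1 S1)). }
  destruct (choice (fun i u => forall d' x o,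
     record_pair ((d, fst (ot i)) :: snd (ot i)) d' x o -> h o x < u)) as [th' Hth'].
  { intros i. apply record_pair_bound; trivial. }
  destruct (RK xi th') as [t1 Ht1], (ub2 t0 t1) as (t2 & Ht02 & Ht12).
  destruct K0 as [k0].
  (* An index [i] and a value below [t2] exclude at most one [k], because [h] is injective below the
     entry at [d] and the maxima for different [k] differ. *)
  destruct (bdd_rel k0 (fun (q : seg xi * seg t2) k => exists j,
     h (fst (ot (fst q))) (X (nn k, j)) = proj1_sig (snd q))) as [k Hk].
  { apply bdd_prod; apply RK. }
  { intros [i v] k k' [j E] [j' E']. cbn in *. rewrite <- E' in E.
    assert (Hlt : forall k j, X (nn k, j) < fst (ot i)).
    { intros k1 j1. exact (lt_le_trans _ _ _ (HU (k1, j1)) (proj1 (Hot i))). }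
    apply h_inj in E; trivial.
    assert (Hne : forall k k' j j', k < k' -> X (nn k, j) <> X (nn k', j')).
    { intros k1 k2 j1 j2 Hl. apply lt_neq.
      apply (wo_trans M _ _ _ (HPhi (nn k1) j1)).
      exact (lt_le_trans _ _ _ (nn_fast _ _ Hl) (proj1 (HX (nn k2, j2)))). }
    destruct (wo_total K k k') as [Hl | [Hl | Hl]]; trivial.
    - destruct (Hne _ _ _ _ Hl E).
    - symmetry in E. destruct (Hne _ _ _ _ Hl E). }
  destruct (HG (nn k)) as (Bg & Hg & _).
  exists (G (nn k)). split; [| split]; trivial. intros i j l Hl.
  destruct (Hot i) as [Ho Ht], (HX (nn k, j)) as (_ & Hx & Hmax).
  replace l with (s (nn k, j) ++ (d, fst (ot i)) :: snd (ot i)).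
  - apply (decodes_app h _ _ _ _ (X (nn k, j)) t2); trivial.
    + exact (lt_le_trans _ _ _ (HU (k, j)) Ho).
    + intros d' x' o' Hr. apply (lt_le_trans _ t0); trivial. rewrite <- (Hnn k).
      exact (wo_trans K _ _ _ (Hth _ _ _ _ Hr) (HTh _ _)).
    + intros d' x' o' Hr. apply (lt_le_trans _ t1); trivial.
      exact (wo_trans K _ _ _ (Hth' _ _ _ _ Hr) (Ht1 _)).
    + intros Hlt. apply (lt_irrefl k). apply (Hk (i, in_seg Hlt)). exists j. reflexivity.
  - apply (walk_unique e e_inj (a i) (A (G (nn k)) j)); trivial.
    apply Hwalk; trivial; try apply Ha. exact (le_trans _ _ _ Hyy1 (proj1 (Ha i))).
Qed.

End Uniform.

(** * Assembling the colouring from walks, decoding, rows and codes *)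

Theorem theorem4p10 :
  GCH ->
  forall (K K1 K2 : WellOrder),
    is_regular_infinite_cardinal K ->
    is_succ_cardinal K K1 ->
    is_succ_cardinal K1 K2 ->
  forall (theta : K2 -> Type),
    (forall delta : K2, inj (theta delta) K1) ->
  forall (p : forall delta : K2, K2 -> K2 -> theta delta),
    Pr0_seq K K2 theta p.
Proof.
  intros gch K M L HK HM HL theta Htheta p.
  destruct (regular_cardinal_regular K HK) as [NK RK].
  assert (Kinf : infinite K) by apply HK.
  pose proof (regular_square NK RK) as Ksq.
  pose proof (succ_no_max K M Kinf Ksq HM) as NM.
  pose proof (succ_regular K M Kinf Ksq HM) as RM.
  pose proof (succ_bdd K M Kinf Ksq HM) as BMK.
  pose proof (regular_square NM RM) as Msq.
  pose proof (succ_infinite K M Kinf HM) as Minf.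
  pose proof (succ_no_max M L Minf Msq HL) as NL.
  pose proof (succ_regular M L Minf Msq HL) as RL.
  pose proof (succ_bdd M L Minf Msq HL) as BLM.
  pose proof (regular_square NL RL) as Lsq.
  pose proof (succ_inhabited K M Kinf HM) as M0.
  pose proof (succ_inhabited M L Minf HL) as L0.
  pose proof (succ_fun_inj K M Kinf Ksq HM gch) as KM_M.
  pose proof (succ_fun_inj M L Minf Msq HL gch) as ML_L.
  assert (K0 : inhabited K) by (destruct Kinf as [n _]; constructor; exact (n 0)).
  pose proof K0 as [k0]. pose proof M0 as [m0]. pose proof L0 as [l0].
  assert (IKM : inj K M) by apply HM.
  assert (IML : inj M L) by apply HL.
  assert (Mseg : forall m : M, inj (seg m) K) by apply HM.
  assert (Lseg : forall b : L, inj (seg b) M) by apply HL.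
  assert (Kseg : forall k : K, inj (seg k) K).
  { intros k. exists (@proj1_sig _ _). apply seg_eq. }
  assert (BLs : forall m : M, bdd L (seg m)).
  { intros m. exact (bdd_inj l0 (inj_trans (Mseg m) IKM) BLM). }
  assert (BMs : forall k : K, bdd M (seg k)).
  { intros k. exact (bdd_inj m0 (Kseg k) BMK). }
  destruct (seg_injections m0 Lseg) as [e e_inj].
  destruct (seg_injections k0 Mseg) as [h h_inj].
  (* A row value holds the index of a partition, a level for the codes and a table of colours. *)
  set (V := (L * M * (M -> M -> M -> L))%type).
  assert (Itask : inj ((M -> K -> L) * V) L).
  { assert (ML : forall X, inj X L -> inj (M -> X) L).
    { intros X I. exact (inj_trans (inj_fun I) ML_L). }
    assert (PL : forall X Y, inj X L -> inj Y L -> inj (X * Y) L).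
    { intros X Y I J. exact (inj_trans (inj_prod I J) Lsq). }
    assert (LL : inj L L) by (exists (fun x => x); auto).
    apply PL; [apply ML, (inj_trans (inj_fun_dom k0 IKM)), ML_L |].
    repeat apply PL; auto. }
  destruct (generic_rows (l0, m0, fun _ _ _ => l0) e M0 L0 e_inj RM BMK Itask) as [row Hrow].
  destruct (separating_codes M0 (succ_inj_pow M L HL) (succ_pow_inj K M Kinf HM gch) Mseg)
    as [code Hcode].
  set (c := fun delta => proj1_sig (constructive_indefinite_description _ (Htheta delta))).
  assert (c_inj : forall delta t t', c delta t = c delta t' -> t = t').
  { intros delta. exact (proj2_sig (constructive_indefinite_description _ (Htheta delta))). }
  set (eval := fun (v : V) (a b : L) => let '(delta, n, R) := v in
                 R (code a n) (code b n) (c delta (p delta a b))).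
  (* The value is well defined because the decoded node is unique; pairs without one get [l0]. *)
  destruct (choice (fun (q : L * L) z => forall d l, Walk e (fst q) (snd q) l -> decodes h l d ->
      z = eval (row (fst q) d) (fst q) (snd q))) as [f Hf].
  { intros [a b]; cbn.
    destruct (classic (exists d l, Walk e a b l /\ decodes h l d)) as [(d & l & Hl & Hd) | N].
    - exists (eval (row a d) a b). intros d' l' Hl' Hd'.
      rewrite (walk_unique e e_inj _ _ _ _ Hl' Hl) in Hd'.
      now rewrite (decodes_unique h l d d' Hd Hd').
    - exists l0. intros d l Hl Hd. destruct N. eauto. }
  exists (fun a b => f (a, b)). intros delta xi A A_inc A_dis zeta.
  destruct (classic (inhabited (seg xi))) as [[i0] | N0].
  2: { exists l0, l0. split; intros i; destruct (N0 (inhabits i)). }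
  assert (A_inj : forall g i j, A g i = A g j -> i = j).
  { intros g i j E. apply seg_eq.
    destruct (wo_total K (proj1_sig i) (proj1_sig j)) as [Hl | [Hl | Hl]]; trivial;
      apply (A_inc g) in Hl; rewrite E in Hl; destruct (lt_irrefl _ Hl). }
  destruct (choice (fun g n => forall i j, code (A g i) n = code (A g j) n -> A g i = A g j)) as [n Hn].
  { intros g. exact (Hcode xi (A g) (BMs xi)). }
  assert (Ipat : inj (M * (seg xi -> M)) M).
  { apply (inj_trans (Y := M * M)); trivial. apply inj_prod.
    - exists (fun x => x). auto.
    - exact (inj_trans (inj_fun_dom i0 (Kseg xi)) KM_M). }
  destruct Ipat as [pat pat_inj].
  (* There are only [M] many patterns, so unboundedly many members share their level and all their
     codes. *)
  destruct (unbounded_fibre (fun g => pat (n g, fun i => code (A g i) (n g))) (fun _ => True) BLM)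
    as [q0 Hq0].
  { intros u. exists u. auto using le_refl. }
  destruct (Hq0 l0) as (g0 & _ & _ & Eg0).
  set (B := fun g => pat (n g, fun i => code (A g i) (n g)) = q0).
  assert (HB : forall g i, B g -> code (A g i) (n g0) = code (A g0 i) (n g0)).
  { intros g i Bg. unfold B in Bg. rewrite <- Eg0 in Bg. apply pat_inj in Bg.
    injection Bg as E1 E2. rewrite E1 in E2. exact (f_equal (fun u => u i) E2). }
  assert (BU : forall u, exists g, u <= g /\ B g).
  { intros u. destruct (Hq0 u) as (g & H1 & _ & H2). eauto. }
  (* The table is well defined because the codes separate the points of [A g0] and [c delta] is
     injective. *)
  destruct (choice (fun (m : M * M * M) z => forall i j t,
     code (A g0 i) (n g0) = fst (fst m) -> code (A g0 j) (n g0) = snd (fst m) ->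
     c delta t = snd m -> z = zeta i j t)) as [R HR].
  { intros m. destruct (classic (exists i j t, code (A g0 i) (n g0) = fst (fst m) /\
      code (A g0 j) (n g0) = snd (fst m) /\ c delta t = snd m)) as [(i & j & t & E1 & E2 & E3) | N].
    - exists (zeta i j t). intros i' j' t' E1' E2' E3'.
      replace i' with i by (apply (A_inj g0), Hn; congruence).
      replace j' with j by (apply (A_inj g0), Hn; congruence).
      replace t' with t by (apply c_inj; congruence). reflexivity.
    - exists l0. intros i j t E1 E2 E3. destruct N. exists i, j, t. auto. }
  set (v := (delta, n g0, fun a b m => R (a, b, m)) : V).
  (* [generic_rows] takes families indexed by all of [K]; [i_of] maps [K] onto [seg xi], with
     repetitions. *)
  destruct (Kseg xi) as [k_of k_of_inj].
  destruct (left_inverse i0 k_of k_of_inj) as [i_of Hi_of].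
  (* [Phi y] caps a block of [M] many members of [B] above [y]; for [d] beyond it, the row value at
     [d] is [v] throughout some member of the block. *)
  destruct (choice (fun y z => exists F : M -> L,
     (forall x, B (F x) /\ forall j, y < A (F x) j /\ A (F x) j < z) /\
     forall d, z < d -> exists x, forall j, row (A (F x) j) d = v)) as [Phi HPhi].
  { intros y.
    destruct (@fast_sequence M L (fun g => B g /\ forall j, y < A g j) (fun x => x) BLs) as (F & HF & Finc).
    { intros u. destruct (far_member L0 NL RL xi A B A_dis BU u y) as (g & H1 & H2 & H3). eauto. }
    assert (F_inj : forall x x', x <> x' -> F x <> F x').
    { intros x x' D. destruct (wo_total M x x') as [Hl | [Hl | Hl]]; [| contradiction |].
      - apply lt_neq, Finc, Hl.
      - apply not_eq_sym, lt_neq, Finc, Hl. }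
    destruct (Hrow (fun x k => A (F x) (i_of k))) with (v := v) as [c0 Hc0].
    { intros x x' k k' D. apply A_dis, F_inj, D. }
    destruct (bdd_prod BLM (bdd_inj l0 (inj_trans (Kseg xi) IKM) BLM)
      (fun q => A (F (fst q)) (snd q))) as [z1 Hz1].
    destruct (ub2 c0 z1) as (z & H1 & H2). exists z, F. split.
    - intros x. destruct (HF x) as [Bx Hx]. split; trivial. intros j. split; trivial.
      exact (lt_le_trans _ _ _ (Hz1 (x, j)) H2).
    - intros d Hd. destruct (Hc0 d (le_lt_trans _ _ _ H1 Hd)) as [x Hx].
      exists x. intros j. rewrite <- (Hi_of j). apply Hx. }
  destruct (spread_point e e_inj M0 L0 NM NL RM RL BMK BLM BLs BMs xi A B A_dis BU Phi)
    as (d & Id & Bd & Hclosed & Hspread).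
  destruct (uniform_decoding e h e_inj h_inj K0 NK RK BMK Mseg BMs xi A B d Id Bd Hspread)
    as (y & Hy & Hdec).
  (* The lower member comes from the block between [y'] and [Phi y'], which lies below [d] by
     closure. *)
  destruct (Hclosed y Hy) as (y' & Hyy' & Hy'd & HPd).
  destruct (HPhi y') as (F & HF & HFrow), (HFrow d HPd) as [x Hx], (HF x) as [Bx Hxa].
  assert (Hxd : forall i, A (F x) i < d).
  { intros i. exact (wo_trans L _ _ _ (proj2 (Hxa i)) HPd). }
  destruct (Hdec (A (F x))) as (g & Bg & Hg & Hdg).
  { intros i. split; trivial. exact (le_trans _ _ _ Hyy' (lt_le _ _ (proj1 (Hxa i)))). }
  assert (Hlt : forall i j, A (F x) i < A g j).
  { intros i j. exact (wo_trans L _ _ _ (Hxd i) (Hg j)). }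
  exists (F x), g. split; trivial. intros i j.
  destruct (walk_exists e _ _ (lt_le _ _ (Hlt i j))) as [l Hl].
  rewrite (Hf (A (F x) i, A g j) d l Hl (Hdg i j l Hl)). cbn. rewrite (Hx i). cbn.
  apply HR; cbn; trivial; symmetry; auto.
Qed.
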